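(* Consider an energy harvesting control system (EHCS) $(A_c,A_o,h,\mathscr{L},\lambda,\bar\varepsilon,B_{\rm cap})$ with $n=1$ (scalar plant). There exists a causal transmission policy $$u^*\big(\varepsilon\,\big|\,\{(S(\tau),x(\tau))\}_{\tau=0}^{t}\big)=\mathbb{P}\big(\mathcal{E}(t)=\varepsilon\,\big|\,\{(S(\tau),x(\tau))\}_{\tau=0}^{t}\big)$$ which stabilizes the EHCS if and only if the process $\{x_{u_g}(t)\}$ generated by the greedy transmission policy $u_g$ is stable. That is, a given EHCS (with $n=1$) is stabilizable if and only if it is stable under the greedy transmission policy.
   Context: EHCS. An EHCS is a 7-tuple $(A_c,A_o,h,\mathscr{L},\lambda,\bar\varepsilon,B_{\rm cap})$: $A_c,A_o\in\mathbb{R}^{n\times n}$ (here $n=1$) are the closed-loop and open-loop plant matrices; $\mathscr{L}$ is the transition matrix of a Markov chain $\{L(t)\}$ on a finite latent set $\mathcal{L}$, with $\mathscr{L}(\ell',\ell)$ the probability of moving from $\ell$ to $\ell'$; $h:\mathcal{L}\to\{0,1,\dots,H_{\max}\}$ gives the harvested energy $H(t)=h(L(t))$; $\lambda$ is the packet reception probability; $\bar\varepsilon$ is the transmission energy threshold; $B_{\rm cap}$ is the finite battery capacity. The latent process is independent of the other stochastic processes of the model. Write $[[y]]=\min(\max(y,0),B_{\rm cap})$. State. $S(t)=(B(t),L(t),\gamma(t),F(t))$, where $B(t)\in\{0,\dots,B_{\rm cap}\}$ is the battery level, $\gamma(t)\in\{0,1\}$ indicates whether the plant receives feedback at time $t$,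 and $F(t)\in\{0,1\}$ indicates whether a transmission was attempted in the previous time slot; $x(t)$ is the plant state and $\mathcal{E}(t)$ the transmission energy chosen at time $t$. A policy specifies the (possibly randomized) choice of $\mathcal{E}(t)$, always subject to the energy availability constraint $\mathcal{E}(t)\le B(t)+H(t)$. Dynamics. $\mathbb{P}(\gamma(t)=1\mid\mathcal{E}(t)=\varepsilon)=\lambda$ if $\varepsilon\ge\bar\varepsilon$ and $0$ otherwise; $B(t+1)=[[B(t)+H(t)-\mathcal{E}(t)]]$; $F(t+1)=1$ if $\mathcal{E}(t)\ge\bar\varepsilon$ and $F(t+1)=0$ otherwise. The plant under policy $u$ satisfies $x_u(t+1)=A_cx_u(t)+\omega(t)$ if $\gamma(t)=1$ and $x_u(t+1)=A_ox_u(t)+\omega(t)$ if $\gamma(t)=0$, where $\{\omega(t)\}$ is i.i.d. with mean zero and finite, positive definite second moment matrix $W$. Greedy policy $u_g$. It uses $\mathcal{E}(t)=\bar\varepsilon$ with probability $1$ if $B(t)+H(t)\ge\bar\varepsilon$, and $\mathcal{E}(t)=0$ with probability $1$ if $B(t)+H(t)<\bar\varepsilon$. Stability. $\{x_u(t)\}$ is stable, and $u$ stabilizes the EHCS, if $\{x_u(t)\}$ is mean-square exponentially ultimately bounded: there exist finite constants $\alpha\ge1$, $\xi\in(0,1)$, $M\ge0$ such that $\mathbb{E}\|x_u(t)\|_2^2\le\alpha\xi^t\,\mathbb{E}\|x_u(0)\|_2^2+M\,\mathrm{Tr}(W)$ for all $t\in\mathbb{Z}_{\ge0}$ and any square integrable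 $x_u(0)$. The EHCS is stabilizable if a stabilizing causal transmission policy exists.
   Formalization: Adds the assumption that |A_o|<1 implies |A_c|<1. Without it the claim fails: for A_o=0, A_c=2, λ=1, ε̄=1, H(t)=1, never transmitting stabilizes the plant but greedy does not. Excluded are only plants with |A_c|≥1>|A_o|. *)

(* Defs.v *)
From HB Require Import structures.
From mathcomp Require Import all_boot all_order all_algebra.
From mathcomp Require Import all_classical all_reals all_analysis.
From mathcomp Require Import measurable_realfun.

Set Implicit Arguments.
Unset Strict Implicit.
Unset Printing Implicit Defensive.

Import Order.TTheory GRing.Theory Num.Theory.
Import numFieldNormedType.Exports.

Local Open Scope classical_set_scope.
Local Open Scope ring_scope.

HB.instance Definition _ (n : nat) := isPointed.Build 'I_n.+1 ord0.

HB.instance Definition _ (n : nat) := @isMeasurable.Build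
  default_measure_display 'I_n.+1 discrete_measurable discrete_measurable0
  discrete_measurableC discrete_measurableU.

Definition points_measurable d (T : measurableType d) :=
  countable [set: T] /\ forall t : T, measurable [set t].

Lemma points_measurable_nat : points_measurable nat.
Proof. by split => //; exact: countableP. Qed.

Lemma points_measurable_bool : points_measurable bool.
Proof. by split => //; exact: countableP. Qed.

Lemma points_measurable_ord n : points_measurable 'I_n.+1.
Proof. by split => //; exact: countableP. Qed.

Lemma points_measurable_prod d1 d2 (T1 : measurableType d1)
    (T2 : measurableType d2) :
  points_measurable T1 -> points_measurable T2 -> points_measurable (T1 * T2)%type.
Proof.
move=> [c1 m1] [c2 m2]; split; first by rewrite -setXTT; exact: countableX.
move=> [x y]; rewrite (_ : [set (x, y)] = [set x] `*` [set y]).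
  exact: measurableX.
by apply/seteqP; split => [[a b] [-> ->]|[a b] [/= -> ->]].
Qed.

Lemma points_measurable_fun d1 d2 (T : measurableType d1)
    (Y : measurableType d2) (f : T -> Y) :
  points_measurable T -> measurable_fun [set: T] f.
Proof.
move=> [cT mT] _ A _; rewrite setTI; apply: countable_measurable => //.
exact: sub_countable (subset_card_le (@subsetT _ _)) cT.
Qed.

Section kernel_operations.
Context d1 d2 d3 (X : measurableType d1) (Y : measurableType d2)
  (Z : measurableType d3) (R : realType).

Section precomposition.
Variables (k : R.-pker Y ~> Z) (f : X -> Y).

Definition kpre (mf : measurable_fun [set: X] f) (x : X) :
  {measure set Z -> \bar R} := k (f x).

Hypothesis mf : measurable_fun [set: X] f.

Let measurable_kpre U :
  measurable U -> measurable_fun [set: X] (kpre mf ^~ U).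
Proof.
move=> mU; apply: (@measurableT_comp _ _ _ _ _ _ (k ^~ U)) => //.
exact: measurable_kernel.
Qed.

HB.instance Definition _ :=
  isKernel.Build _ _ _ _ _ (kpre mf) measurable_kpre.

Let kpre_prob x : kpre mf x [set: Z] = 1%E.
Proof. exact: prob_kernel. Qed.

HB.instance Definition _ :=
  Kernel_isProbability.Build _ _ _ _ _ (kpre mf) kpre_prob.

End precomposition.

Section composition.
Variables (l : R.-pker X ~> Y) (k : R.-pker (X * Y) ~> Z).

Definition pkcomp : X -> {measure set Z -> \bar R} := (mkcomp l k).

Let measurable_pkcomp U :
  measurable U -> measurable_fun [set: X] (pkcomp ^~ U).
Proof. by move=> mU; exact: measurable_kernel. Qed.

HB.instance Definition _ :=
  isKernel.Build _ _ _ _ _ pkcomp measurable_pkcomp.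

Let pkcomp_prob x : pkcomp x [set: Z] = 1%E.
Proof.
rewrite /pkcomp /mkcomp/= /kcomp.
under eq_integral do rewrite prob_kernel.
by rewrite integral_cst// mul1e prob_kernel.
Qed.

HB.instance Definition _ :=
  Kernel_isProbability.Build _ _ _ _ _ pkcomp pkcomp_prob.

End composition.
End kernel_operations.

(* Scalar plant: the plant matrices are 1 x 1, hence elements of R.
   The finite latent set is identified with 'I_latent.+1, and [trans l' l] is
   the probability of moving from l to l'. *)
Record ehcs (R : realType) := Ehcs {
  A_c : R;
  A_o : R;
  latent : nat;
  Hmax : nat;
  harvest : 'I_latent.+1 -> 'I_Hmax.+1;
  trans : 'M[R]_latent.+1;
  lambda : R;
  eps_bar : nat;
  Bcap : nat;
  trans_ge0 : forall l' l, 0 <= trans l' l;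
  trans_sum1 : forall l, \sum_l' trans l' l = 1;
  lambda01 : 0 <= lambda <= 1 }.

(* [[y]] = min(max(y, 0), c) *)
Definition sat (c : nat) (y : int) : 'I_c.+1 :=
  inord `|Num.min (Num.max y 0) c%:Z|%N.

Section process.
Context (R : realType) (sys : ehcs R).

Notation battery_level := 'I_(Bcap sys).+1.
Notation latent_state := 'I_(latent sys).+1.

(* S(t) = (B(t), L(t), gamma(t), F(t)) *)
Definition state : Type :=
  (battery_level * latent_state * bool * bool)%type.

(* (B(t), L(t), F(t)): the part of S(t) determined before the decision E(t);
   gamma(t) is drawn after, and according to, E(t). *)
Definition prestate : Type := (battery_level * latent_state * bool)%type.

HB.instance Definition _ := Measurable.on state.
HB.instance Definition _ := Measurable.on prestate.

(* The information available to the sensor at time t: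
   {(S(tau), x(tau))}_{tau < t}, most recent first, together with the
   pre-decision part of S(t) and x(t). *)
Definition history (t : nat) : Type :=
  (t.-tuple (state * R) * (prestate * R))%type.

HB.instance Definition _ t := Measurable.on (history t).

Definition battery t (h : history t) : battery_level := h.2.1.1.1.
Definition latent_of t (h : history t) : latent_state := h.2.1.1.2.
Definition attempted t (h : history t) : bool := h.2.1.2.
Definition plant t (h : history t) : R := h.2.2.

(* B(t) + H(t) *)
Definition available t (h : history t) : nat :=
  (battery h + harvest (latent_of h))%N.

Definition reception (e : nat) : R :=
  if (eps_bar sys <= e)%N then lambda sys else 0.

(* One slot of randomness besides the policy: gamma(t), L(t+1), omega(t). *)
Definition outcome : Type := (bool * latent_state * R)%type.
HB.instance Definition _ := Measurable.on outcome.

Definition successor t (h : history t) (e : nat) (o : outcome) :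
    history t.+1 :=
  let: (gamma, l', omega) := o in
  ([tuple of
     ((battery h, latent_of h, gamma, attempted h), plant h) :: h.1],
   ((sat (Bcap sys) ((battery h)%:Z + (harvest (latent_of h))%:Z - e%:Z),
     l', (eps_bar sys <= e)%N),
    (if gamma then A_c sys else A_o sys) * plant h + omega)).

Section latent_step.
Variable l : latent_state.

Let trans_nng (i : nat) : {nonneg R} := NngNum (trans_ge0 (inord i) l).

Definition trans_prob : set latent_state -> \bar R :=
  msum (fun i => mscale (trans_nng i) \d_(inord i : latent_state))
    (latent sys).+1.

HB.instance Definition _ := Measure.on trans_prob.

Let trans_prob_setT : trans_prob [set: latent_state] = 1%E.
Proof.
rewrite /trans_prob /msum/= /mscale/=.
under eq_bigr do rewrite diracT mule1 inord_val.
by rewrite sumEFin trans_sum1.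
Qed.

HB.instance Definition _ :=
  @Measure_isProbability.Build _ _ R trans_prob trans_prob_setT.

End latent_step.

Lemma trans_probE l l' : trans_prob l [set l'] = (trans sys l' l)%:E.
Proof.
rewrite /trans_prob /msum/= /mscale/= (bigD1 l')//= inord_val.
rewrite big1 ?adde0; last first.
  move=> i il'; rewrite inord_val diracE memNset ?mule0//=.
  exact/eqP.
by rewrite diracE mem_set// mule1.
Qed.


Lemma measurable_latent_of t : measurable_fun [set: history t] (@latent_of t).
Proof.
exact: (measurableT_comp measurable_snd (measurableT_comp measurable_fst
  (measurableT_comp measurable_fst measurable_snd))).
Qed.

Lemma measurable_battery t : measurable_fun [set: history t] (@battery t).
Proof.
exact: (measurableT_comp measurable_fst (measurableT_comp measurable_fst
  (measurableT_comp measurable_fst measurable_snd))).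
Qed.

Lemma measurable_attempted t : measurable_fun [set: history t] (@attempted t).
Proof.
exact: (measurableT_comp measurable_snd
  (measurableT_comp measurable_fst measurable_snd)).
Qed.

Lemma measurable_plant t : measurable_fun [set: history t] (@plant t).
Proof. exact: (measurableT_comp measurable_snd measurable_snd). Qed.

Section policies.

(* A causal, possibly randomized policy: [pol t h] is the conditional law
   u(. | h) of E(t). *)
Record policy := Policy {
  pol :> forall t : nat, R.-pker (history t) ~> nat;
  pol_available : forall t (h : history t),
    pol t h [set e | (e <= available h)%N] = 1%E }.

Definition greedy_energy t (h : history t) : nat :=
  if (eps_bar sys <= available h)%N then eps_bar sys else 0%N.

Lemma measurable_greedy_energy t :
  measurable_fun [set: history t] (@greedy_energy t).
Proof.
pose f (bl : battery_level * latent_state) : nat :=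
  if (eps_bar sys <= bl.1 + harvest bl.2)%N then eps_bar sys else 0%N.
apply: (@measurableT_comp _ _ _ _ _ _ f _
  (fun h : history t => (battery h, latent_of h))).
  apply: points_measurable_fun; apply: points_measurable_prod;
    exact: points_measurable_ord.
apply/measurable_fun_pairP; split.
  exact: measurable_battery.
exact: measurable_latent_of.
Qed.

Lemma greedy_available t (h : history t) :
  kdirac (R := R) (@measurable_greedy_energy t) h
    [set e | (e <= available h)%N] = 1%E.
Proof.
rewrite /kdirac [LHS]diracE mem_set//= /greedy_energy.
by case: ifP.
Qed.

Definition greedy : policy := Policy greedy_available.

End policies.

Section law.
Variable nu : probability R R.

(* Given E(t) = e and L(t) = l, the reception gamma(t), the next latent state
   L(t+1) and the noise omega(t) are independent of each other and of the past. *)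
Definition outcome_law (el : nat * latent_state) :
    {measure set outcome -> \bar R} :=
  ((bernoulli_prob (reception el.1) \x trans_prob el.2) \x nu)%E.

Let measurable_outcome_law U : measurable U ->
  measurable_fun [set: nat * latent_state] (outcome_law ^~ U).
Proof.
move=> _; apply: points_measurable_fun.
apply: points_measurable_prod; first exact: points_measurable_nat.
exact: points_measurable_ord.
Qed.

HB.instance Definition _ :=
  isKernel.Build _ _ _ _ _ outcome_law measurable_outcome_law.

Let outcome_law_prob el : outcome_law el [set: outcome] = 1%E.
Proof. exact: probability_setT. Qed.

HB.instance Definition _ :=
  Kernel_isProbability.Build _ _ _ _ _ outcome_law outcome_law_prob.

Lemma measurable_energy_latent t : measurable_fun [set: history t * nat]
  (fun he => (he.2, latent_of he.1)).
Proof.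
apply: measurable_fun_pair; first exact: measurable_snd.
exact: (measurableT_comp (@measurable_latent_of t) measurable_fst).
Qed.

Lemma measurable_successor t : measurable_fun [set: (history t * nat) * outcome]
  (fun heo => successor heo.1.1 heo.1.2 heo.2).
Proof.
pose T := ((history t * nat) * outcome)%type.
have mh : measurable_fun [set: T] (fun heo => heo.1.1).
  exact: (measurableT_comp measurable_fst measurable_fst).
have me : measurable_fun [set: T] (fun heo => heo.1.2).
  exact: (measurableT_comp measurable_snd measurable_fst).
have mg : measurable_fun [set: T] (fun heo => heo.2.1.1).
  exact: (measurableT_comp measurable_fst
    (measurableT_comp measurable_fst measurable_snd)).
have ml' : measurable_fun [set: T] (fun heo => heo.2.1.2).
  exact: (measurableT_comp measurable_snd
    (measurableT_comp measurable_fst measurable_snd)).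
have mw : measurable_fun [set: T] (fun heo => heo.2.2).
  exact: (measurableT_comp measurable_snd measurable_snd).
have mb := measurableT_comp (@measurable_battery t) mh.
have ml := measurableT_comp (@measurable_latent_of t) mh.
have mf := measurableT_comp (@measurable_attempted t) mh.
have mx := measurableT_comp (@measurable_plant t) mh.
rewrite (_ : (fun _ => _) = fun heo : T =>
  ([tuple of ((battery heo.1.1, latent_of heo.1.1, heo.2.1.1,
     attempted heo.1.1), plant heo.1.1) :: heo.1.1.1],
   ((sat (Bcap sys) ((battery heo.1.1)%:Z +
       (harvest (latent_of heo.1.1))%:Z - heo.1.2%:Z),
     heo.2.1.2, (eps_bar sys <= heo.1.2)%N),
    (if heo.2.1.1 then A_c sys else A_o sys) * plant heo.1.1 + heo.2.2))).
  2: by apply/funext => -[[h e] [[g l'] w]].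
apply: measurable_fun_pair.
  apply: measurable_cons; last exact: (measurableT_comp measurable_fst mh).
  apply: measurable_fun_pair => //; apply: measurable_fun_pair => //.
  by apply: measurable_fun_pair => //; exact: measurable_fun_pair.
apply: measurable_fun_pair.
  apply: measurable_fun_pair; first apply: measurable_fun_pair => //.
  - pose f (ble : battery_level * latent_state * nat) : battery_level :=
      sat (Bcap sys) ((ble.1.1)%:Z + (harvest ble.1.2)%:Z - ble.2%:Z).
    apply: (@measurableT_comp _ _ _ _ _ _ f _
      (fun heo : T => (battery heo.1.1, latent_of heo.1.1, heo.1.2))).
      apply: points_measurable_fun; apply: points_measurable_prod.
        by apply: points_measurable_prod; exact: points_measurable_ord.
      exact: points_measurable_nat.
    by apply: measurable_fun_pair => //; exact: measurable_fun_pair.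
  - apply: (@measurableT_comp _ _ _ _ _ _ (leq (eps_bar sys)) _
      (fun heo : T => heo.1.2)) => //.
apply: measurable_funD => //; apply: measurable_funM => //.
apply: (@measurableT_comp _ _ _ _ _ _
  (fun g : bool => if g then A_c sys else A_o sys) _
  (fun heo : T => heo.2.1.1)) => //.
Qed.

Definition step (u : policy) t : R.-pker (history t) ~> (history t.+1) :=
  pkcomp (u t) (pkcomp (kpre outcome_law (@measurable_energy_latent t))
                       (kdirac (@measurable_successor t))).

Lemma measurable_start : measurable_fun [set: prestate * R]
  (fun z => ([tuple], z) : history 0).
Proof.
apply: measurable_fun_pair; first exact: measurable_cst.
exact: measurable_id.
Qed.

(* Law of the history at time t, as a kernel from the initial condition
   (B(0), L(0), F(0), x(0)). *)
Fixpoint history_law (u : policy) (t : nat) :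
    R.-pker (prestate * R)%type ~> (history t) :=
  match t with
  | 0 => kdirac measurable_start
  | t'.+1 => pkcomp (history_law u t') (kpre (step u t') measurable_snd)
  end.

(* E[x(t)^2] when (B(0), L(0), F(0), x(0)) has law mu. *)
Definition second_moment (u : policy) (mu : probability (prestate * R)%type R)
    (t : nat) : \bar R :=
  (\int[mu]_z \int[history_law u t z]_h ((plant h) ^+ 2)%:E)%E.

(* The latent process is independent of x(0): beyond L(0) this is built into
   [history_law]. *)
Definition latent_indep (mu : probability (prestate * R)%type R) :=
  forall (l : latent_state) (A : set R), measurable A ->
    (mu [set z | z.1.1.2 = l /\ A z.2] =
     mu [set z | z.1.1.2 = l] * mu [set z | A z.2])%E.

(* Mean-square exponential ultimate boundedness; W is the second moment of the
   noise and alpha, xi, M do not depend on the initial condition. *)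
Definition stabilizes (W : R) (u : policy) : Prop :=
  exists alpha xi M : R,
    [/\ 1 <= alpha, 0 < xi < 1, 0 <= M &
     forall mu : probability (prestate * R)%type R,
       latent_indep mu ->
       (\int[mu]_z (z.2 ^+ 2)%:E < +oo)%E ->
       forall t : nat,
         (second_moment u mu t <=
           (alpha * xi ^+ t)%:E * \int[mu]_z (z.2 ^+ 2)%:E + (M * W)%:E)%E].

Definition stabilizable (W : R) : Prop :=
  exists u : policy, stabilizes W u.

End law.
End process.

(* Main.v *)
(* Averaging over the reception and the noise, one slot multiplies E[x^2] by
   c = lambda A_c^2 + (1 - lambda) A_o^2 if a transmission is attempted and by
   A_o^2 otherwise, and adds W. Let V_n(B, L) be the expected product of these
   factors over n slots under the greedy policy. When A_c^2 <= A_o^2, the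
   dynamic programming inequalities show that no policy makes the expected
   product smaller, so a policy stabilizing the plant forces
   V_n <= alpha xi^n: start it from a deterministic x(0) with an empty battery
   and let x(0) grow. V_n being antitone in B, the bound holds for every battery
   level; hence under the greedy policy the contribution of the noise of each
   past slot decays geometrically, and E[x^2] is bounded by a geometric series.
   Greedy need not minimize E[x(t)^2] itself, since it may reach a drought with
   less stored energy than another policy; only the rate of V_n matters.
   If A_o^2 < 1, V_n decays because A_c^2 < 1 as well; if both squares are at
   least 1, E[x^2] grows by at least W in every slot whatever the policy. *)
Require Import Defs.
From HB Require Import structures.
From mathcomp Require Import all_boot all_order all_algebra.
From mathcomp Require Import all_classical all_reals all_analysis.
From mathcomp Require Import measurable_realfun lra ring zify.

Set Implicit Arguments.
Unset Strict Implicit.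
Unset Printing Implicit Defensive.

Import Order.TTheory GRing.Theory Num.Theory.
Import numFieldNormedType.Exports.

Local Open Scope classical_set_scope.
Local Open Scope ring_scope.

(** * Optimality of the greedy choice *)

(** The energy constraint makes the clamp at 0 inactive, so that battery levels can be compared in
    [nat]. *)
Lemma val_sat (c p q : nat) : (q <= p)%N ->
  sat c (p%:Z - q%:Z) = minn (p - q) c :> nat.
Proof. by move=> qp; rewrite /sat inordK; lia. Qed.

Section value_iteration.
Context (R : realType) (sys : ehcs R).
Notation battery_level := 'I_(Bcap sys).+1.
Notation latent_state := 'I_(latent sys).+1.
Implicit Types (b : battery_level) (l : latent_state) (e n : nat).

Definition gain e : R :=
  reception sys e * A_c sys ^+ 2 + (1 - reception sys e) * A_o sys ^+ 2.

Definition recharge b l e : battery_level :=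
  sat (Bcap sys) (b%:Z + (harvest l)%:Z - e%:Z).

Definition greedy_choice b l : nat :=
  if (eps_bar sys <= b + harvest l)%N then eps_bar sys else 0%N.

Definition averaged (f : battery_level -> latent_state -> R) b l : R :=
  \sum_l' trans sys l' l * f b l'.

(* The V_n of the header. *)
Fixpoint value n b l : R :=
  if n is n'.+1 then
    let e := greedy_choice b l in
    gain e * averaged (value n') (recharge b l e) l
  else 1.

Lemma reception01 e : 0 <= reception sys e <= 1.
Proof.
by rewrite /reception; case: ifP => _; [exact: lambda01 | rewrite lexx ler01].
Qed.

Lemma gain_ge0 e : 0 <= gain e.
Proof.
have /andP[r0 r1] := reception01 e.
by rewrite addr_ge0// mulr_ge0 ?sqr_ge0// subr_ge0.
Qed.

Lemma gain_attempt e : (eps_bar sys <= e)%N -> gain e = gain (eps_bar sys).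
Proof. by rewrite /gain /reception leqnn => ->. Qed.

Lemma gain_idle e : (e < eps_bar sys)%N -> gain e = A_o sys ^+ 2.
Proof.
by move=> ee; rewrite /gain /reception ltn_geF// mul0r add0r subr0 mul1r.
Qed.

Lemma gain_le rho e : A_c sys ^+ 2 <= rho -> A_o sys ^+ 2 <= rho -> gain e <= rho.
Proof.
have /andP[r0 r1] := reception01 e => ca oa; rewrite /gain.
have := ler_wpM2l r0 ca; have : 0 <= 1 - reception sys e by rewrite subr_ge0.
by move=> /ler_wpM2l/(_ _ _ oa); lra.
Qed.

Lemma gain_ge rho e : rho <= A_c sys ^+ 2 -> rho <= A_o sys ^+ 2 -> rho <= gain e.
Proof.
have /andP[r0 r1] := reception01 e => ca oa; rewrite /gain.
have := ler_wpM2l r0 ca; have : 0 <= 1 - reception sys e by rewrite subr_ge0.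
by move=> /ler_wpM2l/(_ _ _ oa); lra.
Qed.

Lemma val_recharge b l e : (e <= b + harvest l)%N ->
  recharge b l e = minn (b + harvest l - e) (Bcap sys) :> nat.
Proof. by move=> ?; rewrite /recharge -PoszD val_sat. Qed.

Lemma averaged_ge0 f b l : (forall l', 0 <= f b l') -> 0 <= averaged f b l.
Proof. by move=> f0; apply: sumr_ge0 => l' _; rewrite mulr_ge0// trans_ge0. Qed.

(** Separate factors [k] and [k'] let the exchange inequality, which pairs two different gains with
    two different batteries, pass under the average over the next latent state. *)
Lemma averaged_le (k k' : R) f f' b b' l :
  (forall l', k * f b l' <= k' * f' b' l') ->
  k * averaged f b l <= k' * averaged f' b' l.
Proof.
move=> ff'; rewrite /averaged !mulr_sumr; apply: ler_sum => l' _.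
by rewrite !(mulrCA _ (trans sys l' l)) ler_wpM2l// trans_ge0.
Qed.

Lemma averaged_le1 f f' b b' l :
  (forall l', f b l' <= f' b' l') -> averaged f b l <= averaged f' b' l.
Proof.
move=> ff'; rewrite -[leLHS]mul1r -[leRHS]mul1r.
by apply: averaged_le => l'; rewrite !mul1r.
Qed.

Lemma averaged_cst (k : R) b l : averaged (fun _ _ => k) b l = k.
Proof. by rewrite /averaged -mulr_suml trans_sum1 mul1r. Qed.

Lemma value_ge0 n b l : 0 <= value n b l.
Proof.
elim: n b l => [|n IH] b l /=; first exact: ler01.
by rewrite mulr_ge0 ?gain_ge0// averaged_ge0.
Qed.

Lemma value_le_exp rho n b l :
  A_c sys ^+ 2 <= rho -> A_o sys ^+ 2 <= rho -> value n b l <= rho ^+ n.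
Proof.
move=> ca oa; have rho0 : 0 <= rho by apply: le_trans ca; exact: sqr_ge0.
elim: n b l => [|n IH] b l /=; first by rewrite expr0.
rewrite exprS ler_pM ?gain_ge0 ?gain_le//; first exact/averaged_ge0/value_ge0.
by rewrite -[leRHS](averaged_cst _ b l); apply: averaged_le1 => l'.
Qed.

(* Second part: eps_bar units of stored energy are worth at most one attempt;
   it is what makes postponing an attempt unprofitable. *)
Lemma value_exchange n : A_c sys ^+ 2 <= A_o sys ^+ 2 ->
  (forall b1 b2 l, (b1 <= b2)%N -> value n b2 l <= value n b1 l) /\
  (forall b1 b2 l, (b1 <= b2 + eps_bar sys)%N ->
     gain (eps_bar sys) * value n b2 l <= A_o sys ^+ 2 * value n b1 l).
Proof.
move=> ca; have gA : gain (eps_bar sys) <= A_o sys ^+ 2 by exact: gain_le.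
have g0 := gain_ge0 (eps_bar sys).
have a0 : 0 <= A_o sys ^+ 2 := sqr_ge0 _.
elim: n => [|n [mono exch]] /=.
  by split=> [|b1 b2 _ _]; rewrite ?mulr1.
(* Monotonicity at [n.+1] comes first, since the exchange at [n.+1] relies on it when [b1 <= b2]. *)
have mono' b1 b2 l : (b1 <= b2)%N -> value n.+1 b2 l <= value n.+1 b1 l.
  move=> b12 /=; rewrite /greedy_choice.
  have [a1|na1] := leqP (eps_bar sys) (b1 + harvest l).
    have a2 : (eps_bar sys <= b2 + harvest l)%N by lia.
    rewrite a2; apply: averaged_le => l'; apply: ler_wpM2l => //.
    by apply: mono; rewrite !val_recharge//; lia.
  have [a2|na2] := leqP (eps_bar sys) (b2 + harvest l).
    (* Only the fuller battery attempts, and it ends up at most [eps_bar] units behind: this is the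
       exchange. Since [b1] cannot afford [eps_bar], the threshold is positive and energy 0 is a
       genuine idle slot. *)
    rewrite (@gain_idle 0); last by lia.
    by apply: averaged_le => l'; apply: exch; rewrite !val_recharge//; lia.
  rewrite (@gain_idle 0); last by lia.
  apply: averaged_le => l'; apply: ler_wpM2l => //.
  by apply: mono; rewrite !val_recharge//; lia.
split=> // b1 b2 l b12.
rewrite -/(value n.+1 b2 l) -/(value n.+1 b1 l).
have [b12'|b21] := leqP b1 b2.
  by apply: ler_pM => //; [exact: value_ge0 | exact: mono'].
rewrite /= /greedy_choice.
have [a2|na2] := leqP (eps_bar sys) (b2 + harvest l).
  have a1 : (eps_bar sys <= b1 + harvest l)%N by lia.
  rewrite a1 mulrCA (mulrCA (A_o _ ^+ 2)); apply: ler_wpM2l => //.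
  by apply: averaged_le => l'; apply: exch; rewrite !val_recharge//; lia.
have [a1|na1] := leqP (eps_bar sys) (b1 + harvest l).
  (* Only [b1] attempts: each side now carries one attempt and one idle slot, and what [b1] has left
     is at most what [b2] holds, so monotonicity concludes. *)
  rewrite (@gain_idle 0); last by lia.
  rewrite mulrCA; do 2 apply: ler_wpM2l => //.
  by apply: averaged_le1 => l'; apply: mono; rewrite !val_recharge//; lia.
rewrite (@gain_idle 0); last by lia.
rewrite mulrCA; apply: ler_wpM2l => //.
by apply: averaged_le => l'; apply: exch; rewrite !val_recharge//; lia.
Qed.

Lemma value_antitone n b1 b2 l : A_c sys ^+ 2 <= A_o sys ^+ 2 ->
  (b1 <= b2)%N -> value n b2 l <= value n b1 l.
Proof. by move=> /(value_exchange n)[+ _]; apply. Qed.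

(** Bellman inequality. Spending more than [eps_bar] only lowers the battery; idling when an attempt
    is affordable is covered by the exchange; when no attempt is affordable, greedy spends nothing
    and keeps the fullest battery. *)
Lemma greedy_optimal n b l e : A_c sys ^+ 2 <= A_o sys ^+ 2 ->
  (e <= b + harvest l)%N ->
  value n.+1 b l <= gain e * averaged (value n) (recharge b l e) l.
Proof.
move=> /(value_exchange n)[mono exch] eb /=; rewrite /greedy_choice.
have a0 : 0 <= A_o sys ^+ 2 := sqr_ge0 _.
have [ee|ee] := leqP (eps_bar sys) e.
  rewrite (leq_trans ee eb) (gain_attempt ee).
  apply: averaged_le => l'; apply: ler_wpM2l; first exact: gain_ge0.
  by apply: mono; rewrite !val_recharge//; lia.
rewrite (gain_idle ee); have [ab|nab] := leqP (eps_bar sys) (b + harvest l).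
  by apply: averaged_le => l'; apply: exch; rewrite !val_recharge//; lia.
rewrite (@gain_idle 0); last by lia.
apply: averaged_le => l'; apply: ler_wpM2l => //.
by apply: mono; rewrite !val_recharge//; lia.
Qed.

End value_iteration.

(** * One slot of the plant dynamics *)

Lemma integral_pkcomp d1 d2 d3 (X : measurableType d1) (Y : measurableType d2)
    (Z : measurableType d3) (R : realType) (l : R.-pker X ~> Y)
    (k : R.-pker (X * Y) ~> Z) x (f : Z -> \bar R) :
  (forall z, 0 <= f z)%E -> measurable_fun [set: Z] f ->
  (\int[pkcomp l k x]_z f z = \int[l x]_y \int[k (x, y)]_z f z)%E.
Proof. exact: (integral_kcomp l k). Qed.

Lemma integral_kdirac d1 d2 (X : measurableType d1) (Y : measurableType d2)
    (R : realType) (g : X -> Y) (mg : measurable_fun [set: X] g) x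
    (f : Y -> \bar R) :
  measurable_fun [set: Y] f -> (\int[kdirac mg x]_y f y = f (g x))%E.
Proof. by move=> mf; rewrite /kdirac integral_dirac// diracT mul1e. Qed.

Section noise.
Context (R : realType) (nu : probability R R) (W : R).
Hypothesis nu_mean : (\int[nu]_w w%:E = 0)%E.
Hypothesis nu_second_moment : (\int[nu]_w (w ^+ 2)%:E = W%:E)%E.

Lemma noise_integrable2 : nu.-integrable [set: R] (fun w => (w ^+ 2)%:E).
Proof.
apply/integrableP; split.
  by apply/measurable_EFinP; exact: measurable_funX.
under eq_integral => w _ do rewrite gee0_abs ?lee_fin ?sqr_ge0//.
by rewrite nu_second_moment ltry.
Qed.

Lemma noise_integrable : nu.-integrable [set: R] EFin.
Proof.
(* The dominating function comes from |w| <= 1 + w^2. *)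
have i1 : nu.-integrable [set: R] (fun w => 1 + (w ^+ 2)%:E)%E.
  apply: integrableD => //; last exact: noise_integrable2.
  exact: finite_measure_integrable_cst.
apply: le_integrable i1 => //= w _.
rewrite lee_fin [leRHS]ger0_norm ?addr_ge0 ?sqr_ge0//.
have [w0|w0] := leP 0 w; [rewrite ger0_norm// | rewrite ltr0_norm//]; nra.
Qed.

(** The cross term 2yw integrates to 0 because the noise is centered. *)
Lemma noise_square (y : R) : (\int[nu]_w ((y + w) ^+ 2)%:E = (y ^+ 2 + W)%:E)%E.
Proof.
have i1 := noise_integrable; have i2 := noise_integrable2.
transitivity (\int[nu]_w ((y ^+ 2)%:E + ((2 * y)%:E * w%:E + (w ^+ 2)%:E)))%E.
  apply: eq_integral => w _; rewrite -EFinM -!EFinD; congr (_%:E).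
  by ring.
have iZ : nu.-integrable [set: R] (fun w => (2 * y)%:E * w%:E)%E.
  exact: integrableZl.
rewrite integralD//; last 2 first.
  exact: finite_measure_integrable_cst.
  exact: integrableD.
rewrite integralD// integralZl// nu_mean mule0 add0e nu_second_moment.
by rewrite integral_cst// [X in (_ * X)%E]probability_setT mule1.
Qed.

End noise.

Section outcome.
Context (R : realType) (sys : ehcs R).

Lemma integral_trans_prob (l : 'I_(latent sys).+1) (f : 'I_(latent sys).+1 -> R) :
  (forall l', 0 <= f l') ->
  (\int[trans_prob l]_l' (f l')%:E = (\sum_l' trans sys l' l * f l')%:E)%E.
Proof.
move=> f0.
have mf : measurable_fun [set: 'I_(latent sys).+1] (fun l' => (f l')%:E).
  by apply: points_measurable_fun; exact: points_measurable_ord.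
rewrite /trans_prob ge0_integral_measure_sum//; last first.
  by move=> l' _; rewrite lee_fin.
under eq_bigr => i _.
  rewrite ge0_integral_mscale//; last by move=> l' _; rewrite lee_fin.
  rewrite integral_dirac// diracT mul1e /= inord_val -EFinM.
  over.
by rewrite sumEFin.
Qed.

Variables (nu : probability R R) (W : R).
Hypothesis nu_mean : (\int[nu]_w w%:E = 0)%E.
Hypothesis nu_second_moment : (\int[nu]_w (w ^+ 2)%:E = W%:E)%E.
Hypothesis W_ge0 : 0 <= W.

(** Tonelli integrates out the noise first, then the next latent state, then the reception. Their
    independence separates the plant factor from the latent average. The weight [f] sees only the
    latent state, as the next battery level is fixed by [e]. *)
Lemma integral_outcome_law e (l : 'I_(latent sys).+1) (x : R) f :
  (forall l', 0 <= f l') ->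
  (\int[outcome_law nu (e, l)]_o
     ((((if o.1.1 then A_c sys else A_o sys) * x + o.2) ^+ 2 * f o.1.2)%:E) =
   ((gain sys e * x ^+ 2 + W) * \sum_l' trans sys l' l * f l')%:E)%E.
Proof.
move=> f0.
have mA : measurable_fun [set: bool * 'I_(latent sys).+1 * R]
   (fun o => (((if o.1.1 then A_c sys else A_o sys) * x + o.2) ^+ 2
              * f o.1.2)%:E).
  apply/measurable_EFinP; apply: measurable_funM.
    apply: measurable_funX; apply: measurable_funD; last exact: measurable_snd.
    apply: measurable_funM => //.
    apply: (@measurableT_comp _ _ _ _ _ _
      (fun g : bool => if g then A_c sys else A_o sys)) => //.
    exact: (measurableT_comp measurable_fst measurable_fst).
  apply: measurableT_comp.
    by apply: points_measurable_fun; exact: points_measurable_ord.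
  exact: (measurableT_comp measurable_snd measurable_fst).
have A0 y l' : 0 <= (y ^+ 2 + W) * f l' by rewrite mulr_ge0 ?addr_ge0 ?sqr_ge0.
have F0 o : (0 <= (((if o.1.1 then A_c sys else A_o sys) * x + o.2) ^+ 2
                    * f o.1.2)%:E)%E.
  by rewrite lee_fin mulr_ge0 ?sqr_ge0.
pose m1 : probability (bool * 'I_(latent sys).+1)%type R :=
  (bernoulli_prob (reception sys e) \x trans_prob l)%E.
etransitivity; first exact: (fubini_tonelli1 (m1 := m1) (m2 := nu) _ mA F0).
rewrite /fubini_F.
transitivity (\int[bernoulli_prob (reception sys e) \x trans_prob l]_gl
   ((((if gl.1 then A_c sys else A_o sys) * x) ^+ 2 + W) * f gl.2)%:E)%E.
  apply: eq_integral => -[g l'] _ /=.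
  under eq_integral => w _ do rewrite EFinM.
  rewrite ge0_integralZr ?lee_fin//; last 2 first.
    by apply/measurable_EFinP; apply: measurable_funX; exact: measurable_funD.
    by move=> w _; rewrite lee_fin sqr_ge0.
  by rewrite (noise_square nu_mean nu_second_moment).
rewrite fubini_tonelli1//; last 2 first.
  apply: points_measurable_fun; apply: points_measurable_prod.
    exact: points_measurable_bool.
  exact: points_measurable_ord.
  by move=> [g l'] /=; rewrite lee_fin.
rewrite /fubini_F /=.
under eq_integral => g _ do rewrite integral_trans_prob//.
rewrite (integral_bernoulli_prob (reception01 sys e)); last first.
  by move=> g; rewrite lee_fin sumr_ge0// => l' _; rewrite mulr_ge0 ?trans_ge0.
rewrite -!EFinM -EFinD; congr (_%:E).
have E (k : R) : \sum_l' trans sys l' l * (k * f l') =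
    k * \sum_l' trans sys l' l * f l'.
  by rewrite mulr_sumr; apply: eq_bigr => l' _; rewrite mulrCA.
by rewrite !E /gain !exprMn /unstable.onem; ring.
Qed.

End outcome.

(** * Second moments along a policy *)

(** A policy meets the energy constraint only with probability one, so pointwise lower bounds are
    available just on a set [D] of full measure. *)
Lemma integral_ge_cst d (T : measurableType d) (R : realType)
    (P : {measure set T -> \bar R}) (D : set T) (f : T -> \bar R) (k : \bar R) :
  measurable D -> P D = 1%E -> measurable_fun [set: T] f ->
  (forall x, 0 <= f x)%E -> (0 <= k)%E -> (forall x, D x -> k <= f x)%E ->
  (k <= \int[P]_x f x)%E.
Proof.
move=> mD PD mf f0 k0 kf.
rewrite (_ : k = (\int[P]_(x in D) cst k x)%E); last first.
  by rewrite integral_cst// PD mule1.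
apply: (@le_trans _ _ (\int[P]_(x in D) f x)%E).
  by apply: ge0_le_integral => //; exact: measurable_funTS.
exact: ge0_subset_integral.
Qed.

Section moments.
Context (R : realType) (sys : ehcs R).
Notation battery_level := 'I_(Bcap sys).+1.
Notation latent_state := 'I_(latent sys).+1.
Implicit Types (f : battery_level -> latent_state -> R) (u : policy sys).

(** With [f = value n] this is, noise aside, the expected square after [n] more greedy slots; with
    [f = value 0] it is the plain square. *)
Definition weighted_square f t (h : history sys t) : \bar R :=
  (plant h ^+ 2 * f (battery h) (latent_of h))%:E.

Lemma measurable_weighted_square f t :
  measurable_fun [set: history sys t] (@weighted_square f t).
Proof.
apply/measurable_EFinP; apply: measurable_funM.
  by apply: measurable_funX; exact: measurable_plant.
apply: (@measurableT_comp _ _ _ _ _ _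
  (fun bl : battery_level * latent_state => f bl.1 bl.2) _
  (fun h : history sys t => (battery h, latent_of h))).
  apply: points_measurable_fun; apply: points_measurable_prod;
    exact: points_measurable_ord.
apply/measurable_fun_pairP; split.
  exact: measurable_battery.
exact: measurable_latent_of.
Qed.

Lemma weighted_square_ge0 f t (h : history sys t) :
  (forall b l, 0 <= f b l) -> (0 <= weighted_square f h)%E.
Proof. by move=> f0; rewrite lee_fin mulr_ge0 ?sqr_ge0. Qed.

Variables (nu : probability R R) (W : R).
Hypothesis nu_mean : (\int[nu]_w w%:E = 0)%E.
Hypothesis nu_second_moment : (\int[nu]_w (w ^+ 2)%:E = W%:E)%E.
Hypothesis W_ge0 : 0 <= W.

Lemma integral_step u t (h : history sys t) f : (forall b l, 0 <= f b l) ->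
  (\int[step nu u t h]_h' weighted_square f h' =
   \int[u t h]_e ((gain sys e * plant h ^+ 2 + W) *
     averaged f (recharge (battery h) (latent_of h) e) (latent_of h))%:E)%E.
Proof.
move=> f0; have mf := @measurable_weighted_square f t.+1.
have f0' h' := weighted_square_ge0 h' f0.
rewrite [LHS]integral_pkcomp//.
apply: eq_integral => e _.
rewrite [LHS]integral_pkcomp//.
transitivity (\int[outcome_law nu (e, latent_of h)]_o
   ((((if o.1.1 then A_c sys else A_o sys) * plant h + o.2) ^+ 2 *
      f (recharge (battery h) (latent_of h) e) o.1.2)%:E))%E.
  apply: eq_integral => -[[g l'] w] _.
  by rewrite integral_kdirac.
by rewrite (integral_outcome_law nu_mean nu_second_moment).
Qed.

Definition moment u f t (z : prestate sys * R) : \bar R :=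
  (\int[history_law nu u t z]_h weighted_square f h)%E.

Lemma moment0 u f z : moment u f 0 z = (z.2 ^+ 2 * f z.1.1.1 z.1.1.2)%:E.
Proof. by rewrite /moment integral_kdirac//; exact: measurable_weighted_square. Qed.

Lemma momentS u f t z : (forall b l, 0 <= f b l) ->
  moment u f t.+1 z =
  (\int[history_law nu u t z]_h \int[step nu u t h]_h' weighted_square f h')%E.
Proof.
move=> f0; rewrite /moment [LHS]integral_pkcomp//.
  by move=> h; exact: weighted_square_ge0.
exact: measurable_weighted_square.
Qed.

Lemma measurable_integral_step u t f : (forall b l, 0 <= f b l) ->
  measurable_fun [set: history sys t]
    (fun h => \int[step nu u t h]_h' weighted_square f h')%E.
Proof.
move=> f0; apply: (measurable_fun_integral_kernel (l := step nu u t)).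
- by move=> U mU; exact: measurable_kernel.
- by move=> h; exact: weighted_square_ge0.
- exact: measurable_weighted_square.
Qed.

Lemma measurable_moment u f t : (forall b l, 0 <= f b l) ->
  measurable_fun [set: prestate sys * R] (moment u f t).
Proof.
move=> f0; apply: (measurable_fun_integral_kernel (l := history_law nu u t)).
- by move=> U mU; exact: measurable_kernel.
- by move=> h; exact: weighted_square_ge0.
- exact: measurable_weighted_square.
Qed.

Lemma moment_ge0 u f t z : (forall b l, 0 <= f b l) -> (0 <= moment u f t z)%E.
Proof. by move=> f0; apply: integral_ge0 => h _; exact: weighted_square_ge0. Qed.

Lemma second_momentE u (mu : probability (prestate sys * R)%type R) t :
  second_moment nu u mu t = (\int[mu]_z moment u (value 0) t z)%E.
Proof.
apply: eq_integral => z _; apply: eq_integral => h _.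
by rewrite /weighted_square /= mulr1.
Qed.

Lemma integral_step_ge u t (h : history sys t) f (k : R) :
  (forall b l, 0 <= f b l) -> 0 <= k ->
  (forall e, (e <= available h)%N ->
    k <= (gain sys e * plant h ^+ 2 + W) *
      averaged f (recharge (battery h) (latent_of h) e) (latent_of h)) ->
  (k%:E <= \int[step nu u t h]_h' weighted_square f h')%E.
Proof.
move=> f0 k0 kf; rewrite integral_step//.
apply: (@integral_ge_cst _ _ _ (u t h) [set e | (e <= available h)%N]).
- by [].
- exact: pol_available.
- by apply: points_measurable_fun; exact: points_measurable_nat.
- move=> e; rewrite lee_fin mulr_ge0 ?averaged_ge0//.
  by rewrite addr_ge0// mulr_ge0 ?gain_ge0 ?sqr_ge0.
- by rewrite lee_fin.
- by move=> e ea; rewrite lee_fin; exact: kf.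
Qed.

(** Under any policy, the square weighted by the value of the remaining horizon is a submartingale:
    [greedy_optimal] gives one slot, and discarding the noise term only lowers the right-hand side.
    The horizon [n] varies in the induction, since going back one slot turns [value n] into
    [value n.+1]. *)
Lemma moment_value_ge u t n z : A_c sys ^+ 2 <= A_o sys ^+ 2 ->
  (moment u (value (t + n)) 0 z <= moment u (value n) t z)%E.
Proof.
move=> ca; elim: t n => [//|t IH] n.
rewrite momentS; last exact: value_ge0.
rewrite addSnnS; apply: (le_trans (IH n.+1)).
apply: ge0_le_integral => //.
- by move=> h _; apply: weighted_square_ge0; exact: value_ge0.
- exact: measurable_weighted_square.
- apply: measurable_integral_step; exact: value_ge0.
move=> h _; apply: integral_step_ge.
- exact: value_ge0.
- by rewrite mulr_ge0 ?sqr_ge0 ?value_ge0.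
move=> e ea; apply: (@le_trans _ _ (plant h ^+ 2 * (gain sys e *
   averaged (value n) (recharge (battery h) (latent_of h) e) (latent_of h)))).
  by apply: ler_wpM2l; [exact: sqr_ge0 | exact: greedy_optimal].
rewrite mulrA; apply: ler_wpM2r; first exact/averaged_ge0/value_ge0.
by rewrite mulrC lerDl.
Qed.

Lemma moment_ge_noise u t z : 1 <= A_c sys ^+ 2 -> 1 <= A_o sys ^+ 2 ->
  ((t%:R * W)%:E <= moment u (value 0) t z)%E.
Proof.
move=> ca oa; elim: t => [|t IH].
  by rewrite mul0r moment_ge0// => *; exact: value_ge0.
rewrite momentS; last exact: value_ge0.
apply: (@le_trans _ _ (\int[history_law nu u t z]_h
    (weighted_square (value 0) h + W%:E))%E).
  rewrite ge0_integralD//; last 2 first.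
  - by move=> h _; apply: weighted_square_ge0; exact: value_ge0.
  - exact: measurable_weighted_square.
  rewrite integral_cst// prob_kernel mule1 -natr1 mulrDl mul1r EFinD.
  by rewrite leeD2r.
apply: ge0_le_integral => //.
- move=> h _; apply: adde_ge0; rewrite ?lee_fin//.
  by apply: weighted_square_ge0; exact: value_ge0.
- by apply: emeasurable_funD => //; exact: measurable_weighted_square.
- apply: measurable_integral_step; exact: value_ge0.
move=> h _; rewrite -EFinD; apply: integral_step_ge.
- exact: value_ge0.
- by rewrite addr_ge0// mulr_ge0 ?sqr_ge0 ?value_ge0.
move=> e _; rewrite averaged_cst !mulr1 lerD2r.
by rewrite -[leLHS]mul1r ler_wpM2r ?sqr_ge0// gain_ge.
Qed.

(** Under greedy the recursion for [value] is exact, so one slot only adds W times an average of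
    [value n], at most [W * alpha * xi ^+ n]. Summing these contributions with growing horizons
    gives the geometric series in the second term. *)
Lemma moment_greedy_le (alpha xi : R) t n z :
  0 <= alpha -> 0 < xi < 1 ->
  (forall m b l, value (sys := sys) m b l <= alpha * xi ^+ m) ->
  (moment (greedy sys) (value n) t z <=
    (alpha * xi ^+ (t + n) * z.2 ^+ 2 + alpha / (1 - xi) * W * xi ^+ n)%:E)%E.
Proof.
move=> a0 /andP[x0 x1] va.
have C0 : 0 <= alpha / (1 - xi) * W by rewrite mulr_ge0// divr_ge0// subr_ge0 ltW.
elim: t n => [|t IH] n.
  rewrite moment0 lee_fin add0n; apply: ler_wpDr.
    by rewrite mulr_ge0// exprn_ge0// ltW.
  by rewrite mulrC ler_wpM2r ?sqr_ge0.
rewrite momentS; last exact: value_ge0.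
apply: (@le_trans _ _ (\int[history_law nu (greedy sys) t z]_h
    (weighted_square (value n.+1) h + (W * (alpha * xi ^+ n))%:E))%E).
  apply: ge0_le_integral => //.
  - move=> h _; apply: integral_ge0 => h' _.
    by apply: weighted_square_ge0; exact: value_ge0.
  - apply: measurable_integral_step; exact: value_ge0.
  - by apply: emeasurable_funD => //; exact: measurable_weighted_square.
  move=> h _; rewrite integral_step; last exact: value_ge0.
  rewrite [leLHS]integral_kdirac; last first.
    by apply: points_measurable_fun; exact: points_measurable_nat.
  rewrite /weighted_square -EFinD lee_fin mulrDl; apply: lerD.
    by rewrite -mulrA mulrCA lexx.
  apply: ler_wpM2l => //.
  rewrite -[leRHS](averaged_cst (sys := sys) _ (battery h) (latent_of h)).
  by apply: averaged_le1 => l'; exact: va.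
rewrite ge0_integralD//; last 3 first.
- by move=> h _; apply: weighted_square_ge0; exact: value_ge0.
- exact: measurable_weighted_square.
- by move=> h _; rewrite lee_fin !mulr_ge0// exprn_ge0// ltW.
rewrite integral_cst// prob_kernel mule1.
apply: (le_trans (leeD2r _ (IH n.+1))).
rewrite -EFinD lee_fin addSnnS -addrA lerD2l.
(* Equality holds: C = alpha W / (1 - xi) solves C xi + alpha W = C. *)
rewrite le_eqVlt; apply/orP; left; apply/eqP.
have nz : 1 - xi != 0 by rewrite subr_eq0 eq_sym lt_eqF.
by rewrite exprS; field.
Qed.

End moments.

(** * Stability *)

Section stability.
Context (R : realType) (sys : ehcs R) (nu : probability R R) (W : R).
Hypothesis nu_mean : (\int[nu]_w w%:E = 0)%E.
Hypothesis nu_second_moment : (\int[nu]_w (w ^+ 2)%:E = W%:E)%E.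
Hypothesis W_gt0 : 0 < W.
Let W_ge0 : 0 <= W := ltW W_gt0.

Lemma latent_indep_dirac (z0 : prestate sys * R) :
  latent_indep (\d_z0 : probability (prestate sys * R)%type R).
Proof.
move=> l A _; rewrite /= !diracE -EFinM -natrM mulnb; congr ((nat_of_bool _)%:R%:E).
by apply/idP/andP; rewrite !inE.
Qed.

Lemma measurable_initial_square :
  measurable_fun [set: prestate sys * R] (fun z => (z.2 ^+ 2)%:E).
Proof. by apply/measurable_EFinP; apply: measurable_funX; exact: measurable_snd. Qed.

(** The constants are uniform over initial laws, so testing on Dirac laws yields a bound for each
    initial condition. *)
Lemma stabilizes_dirac (u : policy sys) : stabilizes nu W u ->
  exists alpha xi M : R, [/\ 1 <= alpha, 0 < xi < 1, 0 <= M &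
    forall z t, (moment nu u (value 0) t z <=
      (alpha * xi ^+ t * z.2 ^+ 2 + M * W)%:E)%E].
Proof.
move=> [alpha [xi [M [a1 x01 M0 H]]]]; exists alpha, xi, M; split=> // z t.
have := H \d_z (@latent_indep_dirac z).
have Ez : (\int[\d_z]_z' (z'.2 ^+ 2)%:E = (z.2 ^+ 2)%:E)%E.
  by rewrite integral_dirac ?diracT ?mul1e//; exact: measurable_initial_square.
rewrite Ez => /(_ (ltry _) t).
rewrite second_momentE integral_dirac//; last first.
  by apply: measurable_moment => *; exact: value_ge0.
by rewrite diracT mul1e.
Qed.

(** For fixed [n], the second moment is at least linear in x(0)^2 with slope [value n], and at most
    affine with slope [alpha * xi ^+ n]; letting x(0) grow compares the slopes. *)
Lemma stabilizes_value_le (u : policy sys) : A_c sys ^+ 2 <= A_o sys ^+ 2 ->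
  stabilizes nu W u -> exists alpha xi : R, [/\ 1 <= alpha, 0 < xi < 1 &
    forall n b l, value (sys := sys) n b l <= alpha * xi ^+ n].
Proof.
move=> ca /stabilizes_dirac[alpha [xi [M [a1 x01 M0 H]]]].
exists alpha, xi; split=> // n b l.
apply: (le_trans (value_antitone n l ca (leq0n b : (ord0 : 'I__) <= b)%N)).
rewrite leNgt; apply/negP; set V := value _ _ _ => aV.
have d0 : 0 < V - alpha * xi ^+ n by rewrite subr_gt0.
(* The initial square [s] makes the excess slope contribute [M * W + 1], just above the offset
   [M * W]. *)
pose s := (M * W + 1) / (V - alpha * xi ^+ n).
have s0 : 0 <= s by rewrite divr_ge0 ?ltW// ltr_wpDl ?ltr01 ?mulr_ge0.
have := H ((ord0, l, false), Num.sqrt s) n.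
have := moment_value_ge nu_mean nu_second_moment W_ge0 u n 0
  ((ord0, l, false), Num.sqrt s) ca.
rewrite addn0 => /le_trans/[apply].
rewrite moment0 lee_fin /= sqr_sqrtr//; apply/negP; rewrite -ltNge.
have sE : (V - alpha * xi ^+ n) * s = M * W + 1 by rewrite mulrC divfK ?gt_eqF.
by rewrite -ltrBrDl (mulrC s) -mulrBl sE ltrDl.
Qed.

Lemma greedy_stabilizes (alpha xi : R) : 1 <= alpha -> 0 < xi < 1 ->
  (forall n b l, value (sys := sys) n b l <= alpha * xi ^+ n) ->
  stabilizes nu W (greedy sys).
Proof.
move=> a1 x01 va; have a0 : 0 <= alpha by exact: le_trans a1.
have /andP[x0 x1] := x01.
exists alpha, xi, (alpha / (1 - xi)).
have M0 : 0 <= alpha / (1 - xi) by rewrite divr_ge0// subr_ge0 ltW.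
split=> // mu _ _ t; rewrite second_momentE.
have k0 : 0 <= alpha * xi ^+ t by rewrite mulr_ge0// exprn_ge0// ltW.
apply: (@le_trans _ _ (\int[mu]_z ((alpha * xi ^+ t)%:E * (z.2 ^+ 2)%:E +
    (alpha / (1 - xi) * W)%:E))%E).
  apply: ge0_le_integral => //.
  - by move=> z _; apply: moment_ge0 => *; exact: value_ge0.
  - by apply: measurable_moment => *; exact: value_ge0.
  - apply: emeasurable_funD => //; apply: measurable_funeM.
    exact: measurable_initial_square.
  move=> z _.
  have := moment_greedy_le nu_mean nu_second_moment W_ge0 t 0 z a0 x01 va.
  by rewrite addn0 expr0 mulr1.
rewrite ge0_integralD//; last 3 first.
- by move=> z _; rewrite -EFinM lee_fin mulr_ge0 ?sqr_ge0.
- by apply: measurable_funeM; exact: measurable_initial_square.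
- by move=> z _; rewrite lee_fin mulr_ge0.
rewrite ge0_integralZl//; last 2 first.
- exact: measurable_initial_square.
- by move=> z _; rewrite lee_fin sqr_ge0.
by rewrite integral_cst// [X in (_ + _ * X)%E]probability_setT mule1.
Qed.

Lemma expanding_not_stabilizable : 1 <= A_c sys ^+ 2 -> 1 <= A_o sys ^+ 2 ->
  ~ stabilizable sys nu W.
Proof.
move=> ca oa [u /stabilizes_dirac[alpha [xi [M [a1 x01 M0 H]]]]].
(* Starting the plant at 0 removes the transient term and leaves [t%:R * W] against the constant
   [M * W]. *)
pose z : prestate sys * R := ((ord0, ord0, false), 0).
have [t Mt] : exists t : nat, M < t%:R.
  by exists (Num.truncn M).+1; exact: truncnS_gt.
have := H z t; rewrite expr0n mulr0 add0r.
have := moment_ge_noise nu_mean nu_second_moment W_ge0 u t z ca oa.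
move=> /le_trans/[apply]; rewrite lee_fin ler_pM2r//.
by rewrite leNgt Mt.
Qed.

End stability.

Theorem theorem2 (R : realType) (sys : ehcs R) (nu : probability R R) (W : R)
    (nu_mean : (\int[nu]_w w%:E = 0)%E)
    (nu_second_moment : (\int[nu]_w (w ^+ 2)%:E = W%:E)%E)
    (W_gt0 : 0 < W)
    (closed_loop : `|A_o sys| < 1 -> `|A_c sys| < 1) :
  stabilizable sys nu W <-> stabilizes nu W (greedy sys).
Proof.
split=> [S|]; last by exists (greedy sys).
have sqr_lt1 (a : R) : (a ^+ 2 < 1) = (`|a| < 1).
  by rewrite -real_normK ?num_real// expr_lt1.
have [ao1|ao1] := ltP `|A_o sys| 1.
  have ac1 := closed_loop ao1; rewrite -!sqr_lt1 in ao1 ac1.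
  (* The floor 1/2 keeps the rate positive even when both plant coefficients vanish. *)
  pose rho := Num.max (Num.max (A_c sys ^+ 2) (A_o sys ^+ 2)) (1 / 2).
  apply: (greedy_stabilizes nu_mean nu_second_moment W_gt0
    (alpha := 1) (xi := rho)) => //.
    rewrite /rho lt_max !gt_max ao1 ac1; apply/andP; split.
      by apply/orP; right; lra.
    by rewrite andTb; lra.
  by move=> n b l; rewrite mul1r value_le_exp// /rho !le_max lexx ?orbT.
rewrite leNgt -sqr_lt1 -leNgt in ao1.
have [ac1|ac1] := leP 1 (A_c sys ^+ 2).
  by have := expanding_not_stabilizable nu_mean nu_second_moment W_gt0 ac1 ao1 S.
(* In the remaining case A_c^2 < 1 <= A_o^2, so feedback helps and the comparison with greedy
   applies. *)
have ca := ltW (lt_le_trans ac1 ao1).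
move: S => [u /(stabilizes_value_le nu_mean nu_second_moment W_gt0 ca)].
move=> [alpha [xi [a1 x01 va]]].
exact: (greedy_stabilizes nu_mean nu_second_moment W_gt0 a1 x01 va).
Qed.
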